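(* Let $0<\alpha\le 1$ and let $\mathcal{R}$ be the operator $\mathcal{R}[\psi(x,t)]=\sum_{p=1}^{M}\sum_{q=0}^{N}c_p(x)\,\psi^p(x,t)\,D_x^q\psi(x,t)+h(x,t)$. Consider the time-fractional equation $D_t^{\alpha}\psi(x,t)=\mathcal{R}[\psi(x,t)]$ with initial condition $\psi(x,0)=f_0(x)$. Let $\phi_0=f_0,\phi_1,\phi_2,\dots$ be the coefficients of its Laplace residual power series (LRPS) solution $$\Psi(x,s)=\frac{f_0(x)}{s}+\sum_{n=1}^{\infty}\frac{\phi_n(x)}{s^{n\alpha+1}},$$ that is, the functions $\phi_k$ satisfy $$\lim_{s\to\infty}s^{k\alpha+1}\,LRes_k(x,s)=0\qquad (k=1,2,\dots),$$ where $LRes_k$ is the $k$-th Laplace residual function of the problem. Then $\phi_1(x)=\mathcal{R}[f_0(x)]\big|_{t=0}$, and for every $k=2,3,\dots$ $$\phi_k(x)=D_t^{(k-1)\alpha}\left(\mathcal{R}\left[f_0(x)+\sum_{m=1}^{k-1}\frac{t^{m\alpha}\,\phi_m(x)}{\Gamma(1+m\alpha)}\right]\right)\Bigg|_{t=0}.$$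
   Context: Here $x$ ranges over an interval $I$ and $t\ge 0$. For $0<\alpha\le1$, $D_t^{\alpha}$ is the Caputo time-fractional derivative $D_t^{\alpha}\psi=I_t^{1-\alpha}\partial_t\psi$, where $I_t^{\beta}\psi(x,t)=\frac{1}{\Gamma(\beta)}\int_0^t(t-\tau)^{\beta-1}\psi(x,\tau)\,d\tau$ for $\beta>0$ and $I_t^0\psi=\psi$. For a positive integer $j$, $D_t^{j\alpha}=D_t^{\alpha}D_t^{\alpha}\cdots D_t^{\alpha}$ ($j$ times) is the sequential (iterated) derivative. $D_x^q$ is the ordinary $q$-th derivative in $x$. The notation $|_{t=0}$ means the value at $t=0$, understood as the limit $t\to0^+$. The Laplace transform in $t$ is $\mathcal{L}\{\psi\}(x,s)=\int_0^\infty\psi(x,t)e^{-st}\,dt$, for $s$ larger than the exponential order of $\psi$, with inverse $\mathcal{L}^{-1}$. For $n\ge0$, $\mathcal{L}^{-1}\{s^{-1-n\alpha}\}=t^{n\alpha}/\Gamma(1+n\alpha)$. In $\mathcal{R}$, $M,N$ are integers with $M\ge 1$, $N\ge 0$; $c_p(x)$ are coefficient functions of $x$; $h(x,t)$ is a given nonhomogeneous term. The $k$-th truncated series is $\Psi_k(x,s)=\frac{f_0(x)}{s}+\sum_{n=1}^{k}\frac{\phi_n(x)}{s^{1+n\alpha}}$, and the $k$-th Laplace residual function is $$LRes_k(x,s)=\Psi_k(x,s)-\frac{f_0(x)}{s}-\frac{1}{s^{\alpha}}\mathcal{L}\left\{\mathcal{R}\left[\mathcal{L}^{-1}\{\Psi_k(x,s)\}\right]\right\}=\sum_{n=1}^{k}\frac{\phi_n(x)}{s^{1+n\alpha}}-\frac{1}{s^{\alpha}}\mathcal{L}\left\{\mathcal{R}\left[f_0(x)+\sum_{n=1}^{k}\frac{\phi_n(x)\,t^{n\alpha}}{\Gamma(1+n\alpha)}\right]\right\}.$$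 Standing conventions: the functions $f_0,\phi_n$ are differentiable in $x$ as often as needed for $\mathcal{R}$ to be applied; functions of $t$ to which the Laplace transform is applied (including $h$ and its iterated Caputo derivatives $D_t^{j\alpha}h$) are piecewise continuous on $[0,\infty)$ and of exponential order, the iterated Caputo derivatives that occur exist, and the rules $\lim_{s\to\infty}s\,\mathcal{L}\{g\}(x,s)=g(x,0)$ and $\mathcal{L}\{D_t^{n\alpha}g\}=s^{n\alpha}\mathcal{L}\{g\}-\sum_{k=0}^{n-1}s^{(n-k)\alpha-1}D_t^{k\alpha}g|_{t=0}$ apply to them. *)

(* Defs.v *)
From HB Require Import structures.
From mathcomp Require Import all_boot all_order all_algebra.
From mathcomp Require Import all_classical all_reals all_analysis.
Set Implicit Arguments.
Unset Strict Implicit.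
Unset Printing Implicit Defensive.
Import Order.TTheory GRing.Theory Num.Theory.
Import numFieldNormedType.Exports.
Local Open Scope classical_set_scope.
Local Open Scope ring_scope.

Section Calculus.
Context {R : realType}.
Implicit Types (g : R -> R) (a b s t : R).

Definition Gamma a : R :=
  \int[lebesgue_measure]_(u in `]0, +oo[) (u `^ (a - 1) * expR (- u)).

Definition Laplace g s : R :=
  \int[lebesgue_measure]_(t in `[0, +oo[) (g t * expR (- (s * t))).

(* g|_{t = 0} is the limit from the right, not the value of g at 0. *)
Definition at0 g : R := lim (g t @[t --> 0^'+]).

(* Riemann-Liouville integral; meaningful for 0 <= b. *)
Definition RLint b g t : R :=
  if b == 0 then g t
  else (Gamma b)^-1 *
       \int[lebesgue_measure]_(tau in `[0, t]) ((t - tau) `^ (b - 1) * g tau).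

Definition caputo a g : R -> R := RLint (1 - a) (derive1 g).

(* Sequential derivative D_t^{j a} = D_t^a ... D_t^a (j times). *)
Definition caputo_iter a (j : nat) g : R -> R := iter j (caputo a) g.

(* D_t^a g exists at every t > 0.  For a = 1 the operator is the plain
   derivative, so that no integral is involved. *)
Definition caputo_exists a g : Prop :=
  forall t, 0 < t -> derivable g t 1 /\
    (a < 1 -> (@lebesgue_measure R).-integrable `[0, t]
       (fun tau => ((t - tau) `^ (- a) * derive1 g tau)%:E)).

(* On [0, +oo[: the value at a break point, in particular at 0, is
   irrelevant. *)
Definition piecewise_continuous g : Prop :=
  [/\ forall T : R, finite_set [set t | 0 < t < T /\ ~ {for t, continuous g}],
      forall t, 0 <= t -> cvg (g u @[u --> t^'+]) &
      forall t, 0 < t -> cvg (g u @[u --> t^'-])].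

Definition exponential_order g : Prop :=
  exists A c : R, \forall t \near +oo, `|g t| <= A * expR (c * t).

Definition initial_value_rule g : Prop :=
  s * Laplace g s @[s --> +oo] --> at0 g.

(* L{D_t^{n a} g} = s^{n a} L{g} - sum_{k < n} s^{(n-k) a - 1} D_t^{k a} g|_0,
   for all s large enough. *)
Definition laplace_caputo_rule a (n : nat) g : Prop :=
  \forall s \near +oo,
    Laplace (caputo_iter a n g) s =
      s `^ (n%:R * a) * Laplace g s
      - \sum_(0 <= k < n) s `^ ((n - k)%:R * a - 1) * at0 (caputo_iter a k g).

(* Derivative at x of a function on I; one-sided when x is an end point of I. *)
Definition quotient_in (f : R -> R) (x y : R) : R := (f y - f x) / (y - x).

Definition deriv_in (I : set R) (f : R -> R) (x : R) : R :=
  lim (quotient_in f x y @[y --> within I x^']).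

Definition deriven_in (I : set R) (q : nat) (f : R -> R) : R -> R :=
  iter q (deriv_in I) f.

Definition times_derivable_in (I : set R) (N : nat) (f : R -> R) : Prop :=
  forall q, (q < N)%N -> forall x, I x ->
    cvg (quotient_in (deriven_in I q f) x y @[y --> within I x^']).

End Calculus.

Section Residual.
Context {R : realType}.
Variables (I : set R) (alpha : R) (M N : nat).
Variables (c : nat -> R -> R) (h : R -> R -> R).
Variables (f0 : R -> R) (phi : nat -> R -> R).

Definition opR (psi : R -> R -> R) (x t : R) : R :=
  \sum_(1 <= p < M.+1) \sum_(0 <= q < N.+1)
    c p x * psi x t ^+ p * deriven_in I q (fun y => psi y t) x
  + h x t.

Definition Psi (k : nat) (x s : R) : R :=
  f0 x / s + \sum_(1 <= n < k.+1) phi n x / s `^ (1 + n%:R * alpha).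

(* The termwise inverse Laplace transform of Psi k, where
   L^{-1}{s^{-1 - n alpha}} = t^{n alpha} / Gamma (1 + n alpha). *)
Definition invPsi (k : nat) (x t : R) : R :=
  f0 x + \sum_(1 <= n < k.+1)
    t `^ (n%:R * alpha) * phi n x / Gamma (1 + n%:R * alpha).

Definition LRes (k : nat) (x s : R) : R :=
  Psi k x s - f0 x / s - (s `^ alpha)^-1 * Laplace (opR (invPsi k) x) s.

End Residual.

(* Main.v *)
Require Import Defs.
From HB Require Import structures.
From mathcomp Require Import all_boot all_order all_algebra.
From mathcomp Require Import all_classical all_reals all_analysis.
From mathcomp Require Import measurable_realfun.
From mathcomp Require Import ring lra.
Import Order.TTheory GRing.Theory Num.Theory.
Import numFieldNormedType.Exports.
Local Open Scope classical_set_scope.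
Local Open Scope ring_scope.

(** Fix [x] in [I] and put [Y = t `^ alpha].  Along a truncated series the
    operator is a polynomial in [Y] plus the source term: on [t >= 0],
    [opR (invPsi k) x t = P_k.[Y] + h x t], where [P_k] does not depend on [t]
    ([opR_invPsi]).  Raising [k] to [k + 1] changes [invPsi k] by a multiple of
    [Y ^+ k.+1], so the coefficient of [Y ^+ k] is the same in [P_k] and
    [P_(k+1)] ([opoly_coef]).  Let [v_j = Gamma (1 + j alpha) * P_j] be the
    normalised coefficients and [u_j] the value at [0] of [D_t^(j alpha) h].
    Both sides of the claim for [k = K + 1] are equal to [v_K + u_K].

    On the Caputo side, [D_t^alpha] maps
    [t `^ (j alpha) / Gamma (1 + j alpha)] to the same expression with [j - 1],
    and kills constants.  Hence [D_t^(K alpha)] shifts the sequence [v] by [K]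
    places and its limit at [0] is [v_K], while [h] contributes [u_K]
    ([caputo_iter_fseriesD], [fseries_at0]).  The shift rests on the identity
    [B(a, b) = Gamma a * Gamma b / Gamma (a + b)] ([eBeta_eGamma]), proved by
    Tonelli's theorem, and on the recursion for [Gamma] ([GammaS]).

    On the Laplace side, the transform of
    [t `^ (j alpha) / Gamma (1 + j alpha)] is [s `^ (- 1 - j alpha)], and the
    transform of [h] is known up to [o(s `^ (- 1 - K alpha))]: the rule for
    [D_t^(K alpha) h] and the initial value rule say that its expansion has the
    coefficients [u_0], ..., [u_K] ([laplace_initial_expansion]).  So the residual
    condition of index [K + 1] says that a polynomial in [s `^ alpha], up to terms
    tending to [0], has a finite limit at infinity.  Such a polynomial is constant
    ([cvg_horner_constant]), and its constant coefficient gives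
    [phi_(K+1) = v_K + u_K] ([leading_balance]).

    The transform of the sum splits because [h x t * expR (- (s * t))] is
    integrable for large [s]; that is what piecewise continuity and exponential
    order give ([laplace_integrable]). *)

(** * Affine change of variable for Lebesgue measure *)

Section Affine.
Context {R : realType}.
Notation mu := (@lebesgue_measure R).
Variables (a b : R).
Hypothesis a0 : 0 < a.

Let aff (x : R) : R := a * x + b.

Let maff : measurable_fun setT aff.
Proof. by apply: measurable_funD => //; exact: measurable_funM. Qed.

Let aff_oc (x y : R) :
  aff @^-1` `]x, y] = `](x - b) / a, (y - b) / a]%classic.
Proof.
by apply/seteqP; split => t /=; rewrite /aff !in_itv/= ltr_pdivrMr// ler_pdivlMr//
  ltrBlDr lerBrDr mulrC.
Qed.

(** The image of Lebesgue measure under [x |-> a * x + b], rescaled by [a], gives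
    half-open intervals their length, so it is Lebesgue measure.  The substitution
    is for measurable rather than continuous [f], as the power functions below are
    unbounded at [0]. *)
Lemma ge0_integral_affine (f : R -> \bar R) :
  measurable_fun setT f -> (forall x, 0 <= f x)%E ->
  (\int[mu]_x f x = a%:E * \int[mu]_x f (a * x + b)%R)%E.
Proof.
move=> mf f0.
(* nu A = a * mu (aff @^-1` A) *)
pose pf : {measure set (measurableTypeR R) -> \bar R} :=
  @measure_function_pushforward__canonical__measure_function_Measure
    _ _ _ (measurableTypeR R) _ mu aff maff.
pose nu := mscale (NngNum (ltW a0)) pf.
have E (A : set (measurableTypeR R)) : measurable A -> mu A = nu A.
  apply: lebesgue_measure_unique => _ [[x y] _ <-].
  rewrite /nu/= /mscale/= /pushforward aff_oc/= !lebesgue_measure_itv/= !lte_fin.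
  rewrite ltr_pM2r ?invr_gt0// ltrD2r; case: ifPn => _; last by rewrite mule0.
  by rewrite -!EFinB -EFinM; congr EFin; field; rewrite gt_eqF.
rewrite (@eq_measure_integral _ _ _ _ nu)/=; last by move=> A mA _; exact: E.
rewrite /nu ge0_integral_mscale//=.
by rewrite ge0_integral_pushforward//=.
Qed.
End Affine.

(** * The Gamma and Beta functions *)

Section Beta.
Context {R : realType}.
Notation mu := (@lebesgue_measure R).
Implicit Types (a b s t u z : R).

(** The exponent is shifted and the function is cut off at [0] so that [Gamma a] is
    the Laplace transform of [tpow a] at [1] and [B(a, b)] the convolution
    of [tpow a] and [tpow b] at [1], both taken over the whole line. *)
Definition tpow a u : R := if 0 < u then u `^ (a - 1) else 0.

Lemma tpow_ge0 a u : 0 <= tpow a u.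
Proof. by rewrite /tpow; case: ifP => // _; exact: powR_ge0. Qed.

Lemma measurable_tpow a : measurable_fun [set: R] (tpow a).
Proof.
by apply: measurable_fun_ifT => //; exact: measurable_fun_ltr.
Qed.

Lemma measurable_tpowc a z : measurable_fun [set: R] (fun y => tpow a (z - y)).
Proof.
by apply: measurableT_comp; [exact: measurable_tpow|exact: measurable_funB].
Qed.

Lemma measurable_expRMN s : measurable_fun [set: R] (fun u => expR (- (s * u))).
Proof.
apply: measurableT_comp; first exact: measurable_expR.
by apply: measurableT_comp.
Qed.

Lemma tpowM a c u : 0 < c -> tpow a (c * u) = c `^ (a - 1) * tpow a u.
Proof.
move=> c0; rewrite /tpow pmulr_rgt0//; case: ifP => [u0|]; last by rewrite mulr0.
by rewrite powRM// ltW.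
Qed.

(** Extended real values let Tonelli's theorem be used before finiteness is known. *)
Definition eGamma a : \bar R := \int[mu]_u (tpow a u * expR (- u))%:E.

Definition eBeta a b : \bar R := \int[mu]_y (tpow a (1 - y) * tpow b y)%:E.

Lemma eGamma_ge0 a : (0 <= eGamma a)%E.
Proof.
by apply: integral_ge0 => u _; rewrite lee_fin mulr_ge0 ?tpow_ge0 ?expR_ge0.
Qed.

Lemma eBeta_ge0 a b : (0 <= eBeta a b)%E.
Proof. by apply: integral_ge0 => u _; rewrite lee_fin mulr_ge0 ?tpow_ge0. Qed.

Let meas_conv a b z :
  measurable_fun [set: R] (fun y => (tpow a (z - y) * tpow b y)%:E).
Proof.
apply/measurable_EFinP; apply: measurable_funM.
  exact: measurable_tpowc.
exact: measurable_tpow.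
Qed.

(** Both factors are homogeneous, so the substitution [y = z * y'] extracts a power
    of [z]. *)
Lemma tpow_convolution a b z :
  (\int[mu]_y (tpow a (z - y) * tpow b y)%:E =
   (tpow (a + b) z)%:E * eBeta a b)%E.
Proof.
rewrite [in RHS]/tpow; case: ltP => z0; last first.
  rewrite mul0e integral0_eq// => y _; rewrite /tpow.
  case: ifPn => [zy|]; last by rewrite mul0r.
  case: ifPn => [y0|]; last by rewrite mulr0.
  rewrite subr_gt0 in zy.
  by have := lt_le_trans (lt_trans y0 zy) z0; rewrite ltxx.
rewrite (@ge0_integral_affine _ z 0)//; last first.
  by move=> y; rewrite lee_fin mulr_ge0 ?tpow_ge0.
under eq_integral => y _.
  rewrite addr0 [X in tpow a X](_ : _ = z * (1 - y)); last by ring.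
  rewrite !tpowM// mulrACA EFinM.
  over.
rewrite ge0_integralZl//=; last 3 first.
  exact: meas_conv.
  by move=> y _; rewrite lee_fin mulr_ge0 ?tpow_ge0.
  by rewrite lee_fin mulr_ge0 ?powR_ge0.
rewrite muleA -EFinM; congr (_%:E * _)%E.
have z0' : z != 0 by rewrite gt_eqF.
rewrite -powRD ?z0' ?implybT// -[X in X * _]powRr1 ?(ltW z0)//.
by rewrite -powRD ?z0' ?implybT//; congr (_ `^ _); ring.
Qed.

(** Tonelli's theorem for [x `^ (a - 1) * y `^ (b - 1) * expR (- (x + y))] on the
    quadrant, integrated along the lines [x + y = z]. *)
Lemma eBeta_eGamma a b :
  (eBeta a b * eGamma (a + b) = eGamma a * eGamma b)%E.
Proof.
pose F (p : R * R) :=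
  (tpow b p.1 * tpow a (p.2 - p.1) * expR (- p.2))%:E.
have mF : measurable_fun setT F.
  apply/measurable_EFinP; apply: measurable_funM.
    apply: measurable_funM.
      by apply: measurableT_comp; [exact: measurable_tpow|exact: measurable_fst].
    apply: measurableT_comp; first exact: measurable_tpow.
    by apply: measurable_funB; [exact: measurable_snd|exact: measurable_fst].
  apply: measurableT_comp; first exact: measurable_expR.
  by apply: measurableT_comp => //; exact: measurable_snd.
have F0 p : (0 <= F p)%E.
  by rewrite lee_fin !mulr_ge0 ?tpow_ge0 ?expR_ge0.
have mG c : measurable_fun [set: R] (fun u => (tpow c u * expR (- u))%:E).
  apply/measurable_EFinP; apply: measurable_funM; first exact: measurable_tpow.
  by apply: measurableT_comp; [exact: measurable_expR|].
have G0 c u : (0 <= (tpow c u * expR (- u))%:E)%E.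
  by rewrite lee_fin mulr_ge0 ?tpow_ge0 ?expR_ge0.
have mGs y :
  measurable_fun [set: R] (fun z => (tpow a (z - y) * expR (- (z - y)))%:E).
  apply: (measurableT_comp (mG a)).
  exact: measurable_funB.
have shift y :
  eGamma a = (\int[mu]_z (tpow a (z - y) * expR (- (z - y)))%:E)%E.
  rewrite /eGamma (@ge0_integral_affine _ 1 (- y))// mul1e.
  by apply: eq_integral => z _; rewrite mul1r.
transitivity (\int[mu]_y \int[mu]_z F (y, z))%E; last first.
  rewrite -(ge0_integralZl mu measurableT (mG b) (fun u _ => G0 b u) (eGamma_ge0 a)).
  apply: eq_integral => y _.
  rewrite (shift y) muleC.
  rewrite -(ge0_integralZl mu measurableT (mGs y) (fun z _ => G0 a (z - y)) (G0 b y)).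
  apply: eq_integral => z _; rewrite -EFinM /F/=; congr EFin.
  rewrite mulrACA -expRD mulrC [in LHS]mulrC; congr (_ * expR _); ring.
rewrite fubini_tonelli// 
  -(ge0_integralZl mu measurableT (mG _) (fun u _ => G0 _ u) (eBeta_ge0 a b)).
apply: eq_integral => z _.
transitivity ((expR (- z))%:E * \int[mu]_y (tpow a (z - y) * tpow b y)%:E)%E.
  by rewrite tpow_convolution EFinM [RHS]muleA [LHS]muleC
    [((expR _)%:E * _)%E]muleC.
rewrite -(ge0_integralZl mu measurableT (meas_conv a b z))//; first last.
  by move=> y _; rewrite lee_fin mulr_ge0 ?tpow_ge0.
apply: eq_integral => y _; rewrite /F/= -EFinM; congr EFin; ring.
Qed.

(** The integrand [y `^ (b - 1)] may be unbounded at [0], so [`]0, 1]] is exhausted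
    by compact intervals on which the fundamental theorem of calculus applies. *)
Lemma eBeta1 b : 0 < b -> eBeta 1 b = (b^-1)%:E.
Proof.
(* n + 2 rather than n + 1: the interval is nondegenerate for n = 0 as well. *)
move=> b0; pose F n := `[n.+2%:R^-1, 1 : R]%classic.
have bigF : \bigcup_n F n = `]0, 1]%classic.
  apply/seteqP; split => [x [n _]|x]; rewrite /F/= !in_itv/=.
    by move=> /andP[nx ->]; rewrite (lt_le_trans _ nx)// invr_gt0.
  move=> /andP[x0 x1].
  exists (Num.trunc x^-1) => //=; rewrite in_itv/= x1 andbT.
  rewrite invf_ple ?posrE//.
  apply: le_trans (ltW (truncnS_gt _)) _.
  by rewrite ler_nat.
have cpow c x : 0 < x -> {for x, continuous (fun y : R => y `^ c)}.
  move=> x0; apply: differentiable_continuous; apply/derivable1_diffP.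
  by apply: derivable_powR; rewrite in_itv/= andbT.
have n0 n : (0 : R) < n.+2%:R^-1 by rewrite invr_gt0.
(* On compact intervals away from 0 the primitive y `^ b / b is available. *)
have FE n : (\int[mu]_(y in F n) (y `^ (b - 1))%:E =
    ((1 - n.+2%:R^-1 `^ b) / b)%:E)%E.
  rewrite (@continuous_FTC2 _ _ (fun y => y `^ b / b)).
  - by rewrite -EFinB powR1 mulrBl.
  - by rewrite invf_lt1 ?ltr1n.
  - apply: continuous_in_subspaceT => x; rewrite inE/= in_itv/= => /andP[nx _].
    by apply: cpow; exact: lt_le_trans nx.
  - split.
    + move=> x; rewrite in_itv/= => /andP[nx _].
      apply: derivableM => //.
      by apply: derivable_powR; rewrite in_itv/= andbT; exact: lt_trans nx.
    + apply: cvg_at_right_filter; apply: cvgM; last exact: cvg_cst.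
      exact: cpow.
    + apply: cvg_at_left_filter; apply: cvgM; last exact: cvg_cst.
      exact: cpow.
  - move=> y; rewrite in_itv/= => /andP[/(lt_trans (n0 n)) y0 _].
    rewrite derive1Mr; last by apply: derivable_powR; rewrite in_itv/= andbT.
    rewrite powR_derive1 ?in_itv/= ?andbT// mulrAC divff ?mul1r// gt_eqF//.
have lim1 : (\int[mu]_(y in F n) (y `^ (b - 1))%:E @[n --> \oo] -->
    (b^-1)%:E)%E.
  under eq_cvg do rewrite FE.
  apply: cvg_EFin; first by near=> n.
  rewrite -[X in _ --> X]mul1r -[X in X / b]subr0.
  apply: cvgM; last exact: cvg_cst.
  apply: cvgB; first exact: cvg_cst.
  move/cvg_at_rightP: (powR_cvg0 b0); apply; split=> //.
  by have := @cvg_harmonic R; rewrite -cvg_shiftS; apply: cvg_trans.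
have lim2 : (\int[mu]_(y in F n) (y `^ (b - 1))%:E @[n --> \oo] -->
    \int[mu]_(y in `]0%R, 1%R]) (y `^ (b - 1))%:E)%E.
  rewrite -bigF; apply: ge0_nondecreasing_set_cvg_integral.
  - move=> m n mn; rewrite subsetEset => x; rewrite /F/= !in_itv/=.
    move=> /andP[mx ->]; rewrite andbT; apply: le_trans mx.
    by rewrite lef_pV2 ?posrE// ler_nat !ltnS.
  - by move=> n; exact: measurable_itv.
  - move=> n; apply: measurable_funTS; apply/measurable_EFinP.
    exact: measurable_powR.
  - by move=> n x _; rewrite lee_fin powR_ge0.
rewrite -(cvg_unique (@ereal_hausdorff R) lim2 lim1).
rewrite -(@integral_itv_bndo_bndc R (BRight 0) 1 (fun y => (y `^ (b - 1))%:E)); last first.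
  apply: measurable_funTS; apply/measurable_EFinP.
  exact: measurable_powR.
rewrite integral_mkcond; apply: eq_integral => y _.
rewrite /patch mem_setE/= in_itv/= /tpow subr_gt0 subrr powRr0.
by case: ltP => y1; case: ltP => y0; rewrite ?mul1r ?mulr0 ?mul0r.
Unshelve. all: by end_near. Qed.

Lemma measurable_eGamma a c :
  measurable_fun [set: R] (fun u => (tpow a u * expR (- (c * u)))%:E).
Proof.
apply/measurable_EFinP/measurable_funM; first exact: measurable_tpow.
exact: measurable_expRMN.
Qed.

Lemma eGamma1 : eGamma 1 = 1%E.
Proof.
rewrite -(@integral_exponential_pdf R 1 ltr01) /eGamma /exponential_pdf.
transitivity (\int[mu]_(u in `[0%R, +oo[) (1 * expR (- 1 * u))%:E)%E; last first.
  rewrite integral_mkcond; apply: eq_integral => u _.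
  by rewrite /patch; case: ifP.
rewrite -(@integral_itv_obnd_cbnd R 0 +oo%O (fun x => (1 * expR (- 1 * x))%:E)).
  rewrite [RHS]integral_mkcond; apply: eq_integral => u _.
  rewrite /patch mem_setE/= in_itv/= andbT /tpow subrr powRr0 mulN1r.
  by case: ltP; rewrite ?mul0r.
apply: measurable_funTS; apply/measurable_EFinP; apply: measurable_funM => //.
by apply: measurableT_comp => //; exact: measurable_funM.
Qed.

(** The case [a = 1] of [eBeta_eGamma]; it carries finiteness from [b] to [1 + b]
    and gives the functional equation. *)
Lemma eGammaS b : 0 < b -> (eGamma b = (b^-1)%:E * eGamma (1 + b))%E.
Proof. by move=> b0; rewrite -eBeta1// eBeta_eGamma eGamma1 mul1e. Qed.

Let meas_gamma a :
  measurable_fun [set: R] (fun u => (tpow a u * expR (- u))%:E).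
Proof.
have := measurable_eGamma a 1; apply: eq_measurable_fun => u _.
by rewrite mul1r.
Qed.

(** For [b <= 1] the integrand is at most [u `^ (b - 1)] on [`]0, 1[] and
    [expR (- u)] beyond; larger [b] follow by the recursion [eGammaS]. *)
Lemma eGamma_lty b : 0 < b -> (eGamma b < +oo)%E.
Proof.
have le1 c : 0 < c <= 1 -> (eGamma c < +oo)%E.
  move=> /andP[c0 c1].
  apply: (@le_lt_trans _ _ (eBeta 1 c + eGamma 1)%E); last first.
    by rewrite eBeta1// eGamma1 -EFinD ltry.
  rewrite -ge0_integralD//; last 4 first.
  - by move=> u _; rewrite lee_fin mulr_ge0 ?tpow_ge0.
  - exact: meas_conv.
  - by move=> u _; rewrite lee_fin mulr_ge0 ?tpow_ge0 ?expR_ge0.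
  - exact: meas_gamma.
  apply: ge0_le_integral => //.
  - by move=> u _; rewrite lee_fin mulr_ge0 ?tpow_ge0 ?expR_ge0.
  - exact: meas_gamma.
  - by apply: emeasurable_funD; [exact: meas_conv|exact: meas_gamma].
  move=> u _; rewrite -EFinD lee_fin /tpow subr_gt0 subrr !powRr0.
  case: ltP => u0; last by rewrite !mul0r mulr0 add0r.
  case: ltP => u1.
    rewrite !mul1r (le_trans (y := u `^ (c - 1)))//.
      by rewrite ler_piMr ?powR_ge0// -expR0 ler_expR oppr_le0 ltW.
    by rewrite lerDl expR_ge0.
  rewrite mul0r add0r ler_wpM2r ?expR_ge0//.
  by rewrite -[leRHS](powRr0 u) ler_powR// subr_le0.
move=> b0; have [n] : exists n : nat, b <= n.+1%:R.
  by exists (Num.trunc b); exact/ltW/truncnS_gt.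
elim: n b b0 => [|n IH] b b0 bn; first by apply: le1; rewrite b0.
have [b1|b1] := leP b 1; first by apply: le1; rewrite b0.
have b10 : 0 < b - 1 by rewrite subr_gt0.
have := IH (b - 1) b10; rewrite lerBlDr natr1 => /(_ bn).
rewrite eGammaS// [1 + _]addrC subrK.
have := eGamma_ge0 b; case: (eGamma b) => [r _ _|_|] //; first exact: ltry.
by rewrite gt0_muley// lte_fin invr_gt0.
Qed.

(** On [`]0, 1[] the exponential is at least [expR (-1)]. *)
Lemma eGamma_gt0 b : 0 < b -> (0 < eGamma b)%E.
Proof.
move=> b0; apply: (@lt_le_trans _ _ ((expR (-1))%:E * eBeta 1 b)%E).
  by rewrite eBeta1// -EFinM lte_fin mulr_gt0 ?expR_gt0 ?invr_gt0.
rewrite -(ge0_integralZl mu measurableT (meas_conv _ _ _))//; last first.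
  by move=> y _; rewrite lee_fin mulr_ge0 ?tpow_ge0.
apply: ge0_le_integral => //.
- by move=> u _; rewrite mule_ge0 ?lee_fin ?mulr_ge0 ?tpow_ge0 ?expR_ge0.
- by apply: emeasurable_funM => //; exact: meas_conv.
- exact: meas_gamma.
move=> u _; rewrite -EFinM lee_fin mulrC /tpow subr_gt0 subrr powRr0.
case: ltP => u1; case: ltP => u0; rewrite ?mul1r ?mul0r ?mulr0 ?mul0r//.
  by rewrite ler_wpM2l ?powR_ge0// ler_expR lerN2 ltW.
by rewrite mulr_ge0 ?powR_ge0 ?expR_ge0.
Qed.

Lemma eGammaE b : 0 < b -> eGamma b = (Gamma b)%:E.
Proof.
move=> b0; rewrite /Gamma /Rintegral integral_mkcond.
rewrite (_ : integral _ _ _ = eGamma b); last first.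
  apply: eq_integral => u _; rewrite /patch mem_setE/= in_itv/= andbT /tpow.
  by case: ltP => _; rewrite ?mul0r.
by rewrite fineK// ge0_fin_numE ?eGamma_ge0// eGamma_lty.
Qed.

Lemma Gamma_gt0 b : 0 < b -> 0 < Gamma b.
Proof. by move=> b0; rewrite -lte_fin -eGammaE// eGamma_gt0. Qed.

Lemma Gamma1 : Gamma 1 = 1 :> R.
Proof. by apply/EFin_inj; rewrite -eGammaE// eGamma1. Qed.

Lemma GammaS b : 0 < b -> Gamma (1 + b) = b * Gamma b.
Proof.
move=> b0; have := eGammaS b b0; rewrite !eGammaE// ?addr_gt0// -EFinM.
by move=> [->]; rewrite mulrA divff ?mul1r// gt_eqF.
Qed.

Lemma eBetaE a b : 0 < a -> 0 < b ->
  eBeta a b = (Gamma a * Gamma b / Gamma (a + b))%:E.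
Proof.
move=> a0 b0; have := eBeta_eGamma a b; rewrite !eGammaE// ?addr_gt0// -EFinM.
have g0 : 0 < Gamma (a + b) by rewrite Gamma_gt0 ?addr_gt0.
have := eBeta_ge0 a b; case: (eBeta a b) => //= [r _|_].
  by rewrite -EFinM => -[<-]; rewrite mulfK ?gt_eqF.
by rewrite gt0_mulye ?lte_fin.
Qed.

Lemma tpow_laplace s a : 0 < s -> 0 < a ->
  (\int[mu]_u (tpow a u * expR (- (s * u)))%:E = (Gamma a / s `^ a)%:E)%E.
Proof.
move=> s0 a0; have sa : 0 < s `^ a by exact: powR_gt0.
apply/esym; rewrite EFinM -eGammaE//.
rewrite /eGamma (@ge0_integral_affine _ s 0)//; last first.
  by move=> u; rewrite lee_fin mulr_ge0 ?tpow_ge0 ?expR_ge0.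
under eq_integral do rewrite addr0 tpowM// -mulrA EFinM.
rewrite ge0_integralZl//; last 3 first.
- exact: measurable_eGamma.
- by move=> u _; rewrite lee_fin mulr_ge0 ?tpow_ge0 ?expR_ge0.
- by rewrite lee_fin powR_ge0.
rewrite muleA -EFinM mulr_powRB1 ?ltW//.
by rewrite muleAC -EFinM divff ?mul1e// gt_eqF.
Qed.

End Beta.

(** * Caputo derivatives of fractional power series *)

Section CaputoSeries.
Context {R : realType}.
Notation mu := (@lebesgue_measure R).
Implicit Types (a b s t u x : R) (f g : R -> R).

Lemma cvg_sum_ord (T : Type) (F : set_system T) {FF : Filter F} (n : nat)
    (f : nat -> T -> R) (l : nat -> R) :
  (forall i, (i < n)%N -> f i x @[x --> F] --> l i) ->
  \sum_(i < n) f i x @[x --> F] --> \sum_(i < n) l i.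
Proof.
elim: n => [|n IH] fl.
  by under eq_cvg do rewrite big_ord0; rewrite big_ord0; exact: cvg_cst.
under eq_cvg do rewrite big_ord_recr; rewrite big_ord_recr/=.
by apply: cvgD; [apply: IH => i /ltnW; exact: fl|exact: fl].
Qed.

(** A Caputo derivative integrates from [0] a derivative that is only controlled on
    [t > 0]; the value at [0] does not change the integral. *)
Lemma eq_oc_integral f g (b : itv_bound R) :
  {in [set` Interval (BRight 0) b], f =1 g} ->
  mu.-integrable [set` Interval (BLeft 0) b] (EFin \o g) ->
  mu.-integrable [set` Interval (BLeft 0) b] (EFin \o f) /\
  \int[mu]_(x in [set` Interval (BLeft 0) b]) f x =
  \int[mu]_(x in [set` Interval (BLeft 0) b]) g x.
Proof.
move=> fg /integrableP[mg ig].
have mg' := (emeasurable_fun_itv_obnd_cbndP _ _ _).2 mg.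
have mf' : measurable_fun [set` Interval (BRight 0) b] (EFin \o f).
  by apply: eq_measurable_fun mg' => x xb; rewrite /= fg.
have mf := (emeasurable_fun_itv_obnd_cbndP _ _ _).1 mf'.
have eint (k : R -> R) : measurable_fun setT k ->
    (\int[mu]_(x in [set` Interval (BLeft 0%R) b]) (k (f x))%:E =
     \int[mu]_(x in [set` Interval (BLeft 0%R) b]) (k (g x))%:E)%E.
  move=> mk; rewrite -!integral_itv_obnd_cbnd.
  - by apply: eq_integral => x xb; rewrite fg.
  - apply/measurable_EFinP; apply: measurableT_comp => //.
    exact/measurable_EFinP.
  - apply/measurable_EFinP; apply: measurableT_comp => //.
    exact/measurable_EFinP.
split; last by rewrite /Rintegral (eint id).
apply/integrableP; split => //=.
have /= -> := eint Num.norm; first exact: ig.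
exact: normr_measurable.
Qed.

(** The convolution at [t] of two truncated powers, which vanish outside [`]0, t[]. *)
Lemma beta_integral a b t : 0 < a -> 0 < b -> 0 < t ->
  mu.-integrable `[0, t] (EFin \o (fun y => (t - y) `^ (a - 1) * y `^ (b - 1))) /\
  \int[mu]_(y in `[0, t]) ((t - y) `^ (a - 1) * y `^ (b - 1)) =
  t `^ (a + b - 1) * (Gamma a * Gamma b / Gamma (a + b)).
Proof.
move=> a0 b0 t0; set K := (fun y => _ * _).
have mK : measurable_fun setT K.
  apply: measurable_funM; last exact: measurable_powR.
  rewrite (_ : (fun _ => _) = (@powR R ^~ (a - 1)) \o (fun y => t - y))//.
  apply: measurableT_comp; first exact: measurable_powR.
  exact: measurable_funB.
have K0 y : 0 <= K y by rewrite mulr_ge0 ?powR_ge0.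
have EK : (\int[mu]_(y in `[0%R, t]) (K y)%:E =
    (t `^ (a + b - 1) * (Gamma a * Gamma b / Gamma (a + b)))%:E)%E.
  rewrite EFinM -eBetaE//.
  transitivity ((tpow (a + b) t)%:E * eBeta a b)%E; last by rewrite /tpow t0.
  rewrite -tpow_convolution integral_itv_bndoo; last first.
    by apply: measurable_funTS; exact/measurable_EFinP.
  rewrite integral_mkcond; apply: eq_integral => y _.
  rewrite /patch mem_setE/= in_itv/= /tpow subr_gt0 /K.
  by case: (ltP 0 y) => _; case: (ltP y t) => _/=; rewrite ?mulr0 ?mul0r.
split; last by rewrite /Rintegral EK.
apply/integrableP; split; first by apply: measurable_funTS; exact/measurable_EFinP.
under eq_integral do rewrite /= ger0_norm//.
by rewrite EK ltry.
Qed.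

Variable alpha : R.
Hypothesis alpha01 : 0 < alpha <= 1.
Let alpha0 : 0 < alpha. Proof. by case/andP: alpha01. Qed.

(** With this normalisation the Caputo derivative lowers the index by one, without
    a factor. *)
Definition fmono (j : nat) t : R :=
  t `^ (j%:R * alpha) / Gamma (1 + j%:R * alpha).

Definition fmono_pred j t : R := if j is j'.+1 then fmono j' t else 0.

Lemma is_derive_fmono j t : 0 < t ->
  is_derive t 1 (fmono j)
    (j%:R * alpha * t `^ (j%:R * alpha - 1) / Gamma (1 + j%:R * alpha)).
Proof.
move=> t0; rewrite /fmono.
have d := is_derive1_powR (j%:R * alpha) t0.
under [X in is_derive _ _ X]eq_fun do rewrite mulrC.
by apply: is_derive_eq; rewrite /GRing.scale/= mulrC.
Qed.

(** The derivative of [fmono j] at [t > 0]. *)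
Let dmono j t : R :=
  j%:R * alpha * t `^ (j%:R * alpha - 1) / Gamma (1 + j%:R * alpha).

Let ja0 j : 0 < j.+1%:R * alpha. Proof. by rewrite mulr_gt0. Qed.

Let dmono0 : dmono 0 = fun=> 0.
Proof. by apply/funext => t; rewrite /dmono !mul0r. Qed.

Let dmonoS j t :
  dmono j.+1 t = (Gamma (j.+1%:R * alpha))^-1 * t `^ (j.+1%:R * alpha - 1).
Proof.
rewrite /dmono GammaS//; have := ja0 j; move: (_ * alpha) => b b0.
have : 0 < Gamma b by exact: Gamma_gt0.
by move=> ?; field; rewrite !gt_eqF.
Qed.

(** The Beta integral with [a = 1 - alpha] and [b = j alpha]; the two Gamma factors
    cancel against the normalisations of [fmono] and of the fractional integral. *)
Let dmono_int j t : alpha < 1 -> 0 < t ->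
  mu.-integrable `[0, t] (EFin \o (fun y => (t - y) `^ (- alpha) * dmono j y)) /\
  (Gamma (1 - alpha))^-1 *
   \int[mu]_(y in `[0, t]) ((t - y) `^ (- alpha) * dmono j y) = fmono_pred j t.
Proof.
move=> a1 t0; have b1 : 0 < 1 - alpha by rewrite subr_gt0.
case: j => [|j].
  rewrite dmono0 (_ : (fun y => (t - y) `^ (- alpha) * 0) = fun=> 0); last first.
    by apply/funext => y; rewrite mulr0.
  by split; [exact: integrable0|rewrite /Rintegral integral0 mulr0].
have [] := beta_integral _ _ _ b1 (ja0 j) t0.
rewrite (_ : 1 - alpha - 1 = - alpha); last by ring.
rewrite (_ : 1 - alpha + j.+1%:R * alpha - 1 = j%:R * alpha); last first.
  by rewrite -natr1; ring.
rewrite (_ : 1 - alpha + j.+1%:R * alpha = 1 + j%:R * alpha); last first.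
  by rewrite -natr1; ring.
pose K y := (t - y) `^ (- alpha) * y `^ (j.+1%:R * alpha - 1).
move=> iK vK.
rewrite (_ : (fun y => (t - y) `^ (- alpha) * dmono j.+1 y) =
  fun y => (Gamma (j.+1%:R * alpha))^-1 * K y).
  split.
    exact: (integrableZl _ (Gamma (j.+1%:R * alpha))^-1 iK).
  rewrite RintegralZl// vK /= /fmono.
  have := Gamma_gt0 _ b1; have := Gamma_gt0 _ (ja0 j).
  have j1 : 0 < 1 + j%:R * alpha.
    by rewrite ltr_pwDl// mulr_ge0// ltW.
  have := Gamma_gt0 _ j1.
  move: (Gamma (1 - alpha)) (Gamma (j.+1%:R * alpha)) (Gamma (1 + j%:R * alpha)).
  move: (t `^ _) => p x y z z0 y0 x0.
  by field; rewrite !gt_eqF.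
by apply/funext => y; rewrite dmonoS /K mulrCA.
Qed.

(** For [alpha < 1] the integral splits because both kernels are integrable; for
    [alpha = 1] the operator is the derivative and the claim is [GammaS]. *)
Lemma caputo_fmonoD j c g : caputo_exists alpha g ->
  caputo_exists alpha (fun t => c * fmono j t + g t) /\
  forall t, 0 < t -> caputo alpha (fun t => c * fmono j t + g t) t =
    c * fmono_pred j t + caputo alpha g t.
Proof.
move=> cg.
have D t : 0 < t -> is_derive t 1 (fun t => c * fmono j t + g t)
    (c * dmono j t + derive1 g t).
  move=> t0; have [dg _] := cg t t0.
  have dm := is_derive_fmono j t t0.
  have dg' : is_derive t 1 g (derive1 g t).
    by rewrite derive1E; exact/derivableP.
  by apply: is_deriveD.
have D1 t : 0 < t -> derive1 (fun t => c * fmono j t + g t) t =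
    c * dmono j t + derive1 g t.
  by move=> t0; rewrite derive1E; apply: derive_val; exact: D.
have I t : alpha < 1 -> 0 < t ->
    mu.-integrable `[0, t] (EFin \o (fun y => (t - y) `^ (- alpha) *
      derive1 (fun t => c * fmono j t + g t) y)) /\
    \int[mu]_(y in `[0, t]) ((t - y) `^ (- alpha) *
      derive1 (fun t => c * fmono j t + g t) y) =
    c * \int[mu]_(y in `[0, t]) ((t - y) `^ (- alpha) * dmono j y) +
    \int[mu]_(y in `[0, t]) ((t - y) `^ (- alpha) * derive1 g y).
  move=> a1 t0; have [im _] := dmono_int j t a1 t0.
  have [_ /(_ a1) ig] := cg t t0.
  have icm : mu.-integrable `[0, t] (EFin \o (fun y => c * ((t - y) `^ (- alpha) * dmono j y))).
    exact: (integrableZl _ c im).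
  rewrite -RintegralZl// -RintegralD//.
  apply: eq_oc_integral.
    move=> y; rewrite inE/= in_itv/= => /andP[y0 _].
    by rewrite D1// mulrDr mulrCA.
  exact: (integrableD _ icm ig).
split.
  move=> t t0; split; first by have [] := D t t0.
  by move=> a1; have [] := I t a1 t0.
move=> t t0; rewrite /caputo /RLint subr_eq0.
have [a1|a1] := eqVneq 1 alpha.
  rewrite D1//; congr (c * _ + _).
  case: j {D D1 I} => [|j]; first by rewrite dmono0.
  rewrite dmonoS/= /fmono -a1 !mulr1 mulrC -natr1 addrK.
  by rewrite addrC.
have {}a1 : alpha < 1 by case/andP: alpha01 => _; rewrite le_eqVlt eq_sym (negbTE a1).
rewrite (_ : 1 - alpha - 1 = - alpha); last by ring.
have [_ ->] := I t a1 t0; have [_ <-] := dmono_int j t a1 t0.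
by rewrite mulrDr mulrCA.
Qed.

(** Derivatives at [t > 0] are local and the value of the integrand at [0] is
    immaterial, so equality on [t > 0] passes through the Caputo derivative. *)
Lemma eq_caputo f g : caputo_exists alpha g -> (forall t, 0 < t -> f t = g t) ->
  caputo_exists alpha f /\ forall t, 0 < t -> caputo alpha f t = caputo alpha g t.
Proof.
move=> cg fg.
have nfg t : 0 < t -> \forall y \near t, f y = g y.
  by move=> t0; near=> y; apply: fg; near: y; exact: lt_nbhsr.
have D1 t : 0 < t -> derive1 f t = derive1 g t.
  by move=> t0; rewrite !derive1E; apply: near_eq_derive; exact: nfg.
have I t : alpha < 1 -> 0 < t ->
    mu.-integrable `[0, t] (EFin \o (fun y => (t - y) `^ (- alpha) * derive1 f y)) /\
    \int[mu]_(y in `[0, t]) ((t - y) `^ (- alpha) * derive1 f y) =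
    \int[mu]_(y in `[0, t]) ((t - y) `^ (- alpha) * derive1 g y).
  move=> a1 t0; apply: eq_oc_integral; last by have [_ /(_ a1)] := cg t t0.
  by move=> y; rewrite inE/= in_itv/= => /andP[y0 _]; rewrite D1.
split.
  move=> t t0; split.
    have [dg _] := cg t t0; apply: near_eq_derivable dg.
    by near=> y; apply/esym; near: y; exact: nfg.
  by move=> a1; have [] := I t a1 t0.
move=> t t0; rewrite /caputo /RLint subr_eq0.
have [a1|a1] := eqVneq 1 alpha; first by rewrite D1.
have {}a1 : alpha < 1 by case/andP: alpha01 => _; rewrite le_eqVlt eq_sym (negbTE a1).
rewrite (_ : 1 - alpha - 1 = - alpha); last by ring.
by have [_ ->] := I t a1 t0.
Unshelve. all: by end_near. Qed.

Definition fseries (v : nat -> R) n t : R := \sum_(j < n) v j * fmono j t.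

Lemma caputo_fseriesD v n g : caputo_exists alpha g ->
  caputo_exists alpha (fun t => fseries v n t + g t) /\
  forall t, 0 < t -> caputo alpha (fun t => fseries v n t + g t) t =
    fseries (v \o S) n.-1 t + caputo alpha g t.
Proof.
elim: n g => [|n IH] g cg.
  rewrite (_ : (fun t => _) = g); last first.
    by apply/funext => t; rewrite /fseries big_ord0 add0r.
  by split=> // t t0; rewrite /fseries big_ord0 add0r.
have [cg' vg'] := caputo_fmonoD n (v n) g cg.
have [cg'' vg''] := IH _ cg'.
rewrite (_ : (fun t => _) =
    fun t => fseries v n t + (v n * fmono n t + g t)); last first.
  by apply/funext => t; rewrite /fseries big_ord_recr/= addrA.
split; first exact: cg''.
move=> t t0; rewrite (vg'' t t0) (vg' t t0) addrA [n.+1.-1]/=; congr (_ + _).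
clear; case: n => [|n]; first by rewrite mulr0 addr0.
by rewrite /fseries big_ord_recr.
Qed.

(** Each step discards the constant term of the series and shifts the others. *)
Lemma caputo_iter_fseriesD v n f h m :
  (forall j, caputo_exists alpha (caputo_iter alpha j h)) ->
  (forall t, 0 < t -> f t = fseries v n t + h t) ->
  forall t, 0 < t -> caputo_iter alpha m f t =
    fseries (fun j => v (j + m)%N) (n - m) t + caputo_iter alpha m h t.
Proof.
move=> ch; elim: m => [|m IH] fE t t0.
  by rewrite /= fE// subn0; congr (_ + _); apply: eq_bigr => j _; rewrite addn0.
have [_ c2] := caputo_fseriesD (fun j => v (j + m)%N) (n - m) _ (ch m).
have [_ /= ->//] := eq_caputo _ _ (proj1 (caputo_fseriesD _ _ _ (ch m))) (IH fE).
rewrite c2// subnS; congr (_ + _); apply: eq_bigr => j _.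
by rewrite /= addSnnS.
Qed.

Lemma fmono0 t : fmono 0 t = 1.
Proof. by rewrite /fmono !mul0r addr0 powRr0 Gamma1 divr1. Qed.

Lemma fseries_at0 v n : fseries v n.+1 t @[t --> 0^'+] --> v 0%N.
Proof.
rewrite (_ : fseries v n.+1 =
    fun t => v 0%N + \sum_(i < n) v i.+1 * fmono i.+1 t); last first.
  by apply/funext => t; rewrite /fseries big_ord_recl/= fmono0 mulr1.
suff lim0 : \sum_(i < n) v i.+1 * fmono i.+1 t @[t --> 0^'+] --> (0 : R).
  have := cvgD (cvg_cst (v 0%N)) lim0.
  by rewrite addr0; apply.
have := @cvg_sum_ord R (0^'+) _ n (fun i t => v i.+1 * fmono i.+1 t)
  (fun i => v i.+1 * (0 / Gamma (1 + i.+1%:R * alpha))).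
rewrite (@big1 _ _ _ _ _ _ (fun i : 'I_n => _ * (0 / _))); last first.
  by move=> i _; rewrite mul0r mulr0.
apply => i _; apply: cvgM; first exact: cvg_cst.
apply: cvgM; last exact: cvg_cst.
by apply: powR_cvg0; exact: ja0.
Qed.

End CaputoSeries.

(** * Laplace transforms of sources and of fractional powers *)

Section LaplaceTransform.
Context {R : realType}.
Notation mu := (@lebesgue_measure R).
Implicit Types (a b s t u x : R) (f g h : R -> R).

(** The substitution [u = s * t] in the integral defining [Gamma (1 + a)]. *)
Lemma laplace_powR s a : 0 < s -> 0 <= a ->
  mu.-integrable `[0, +oo[ (EFin \o (fun t => t `^ a * expR (- (s * t)))) /\
  \int[mu]_(t in `[0, +oo[) (t `^ a * expR (- (s * t))) =
  Gamma (1 + a) / s `^ (1 + a).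
Proof.
move=> s0 a0; pose K t := t `^ a * expR (- (s * t)).
have mK : measurable_fun setT K.
  apply: measurable_funM; first exact: measurable_powR.
  exact: measurable_expRMN.
have K0 t : 0 <= K t by rewrite mulr_ge0 ?powR_ge0 ?expR_ge0.
have EK : (\int[mu]_(t in `[0%R, +oo[) (K t)%:E =
    (Gamma (1 + a) / s `^ (1 + a))%:E)%E.
  rewrite -tpow_laplace//; last by rewrite ltr_pwDl.
  rewrite -(@integral_itv_obnd_cbnd R 0 +oo%O (fun t => (K t)%:E)); last first.
    by apply: measurable_funTS; exact/measurable_EFinP.
  rewrite integral_mkcond; apply: eq_integral => t _.
  rewrite /patch mem_setE/= in_itv/= andbT /tpow [1 + a]addrC addrK /K.
  by case: (ltP 0 t) => _; rewrite ?mul0r.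
split; last by rewrite /Rintegral EK.
apply/integrableP; split; first by apply: measurable_funTS; exact/measurable_EFinP.
under eq_integral do rewrite /= (ger0_norm (K0 _)).
by rewrite EK ltry.
Qed.

Lemma countable_measurable_fun (D : set R) h : countable D -> measurable_fun D h.
Proof.
move=> cD _ Y _; apply: countable_measurable => //.
by apply: sub_countable cD; apply: subset_card_le; exact: subIsetl.
Qed.

(** Finitely many break points in each [`]0, n[] make countably many in all; off
    this set the function is continuous, and on it there is nothing to check. *)
Lemma piecewise_continuous_measurable h : piecewise_continuous h ->
  measurable_fun `[(0 : R), +oo[ h.
Proof.
move=> [fin _ _]; pose D := [set t | 0 < t /\ ~ {for t, continuous h}].
have cD : countable D.
  rewrite (_ : D = \bigcup_(n in @setT nat) [set t | 0 < t < n%:R /\ ~ {for t, continuous h}]).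
    by apply: bigcup_countable => // n _; exact/finite_set_countable/fin.
  apply/seteqP; split => [t [t0 ct]|t [n _ [/andP[t0 _] ct]]]; last by split.
  by exists (Num.trunc t).+1 => //; split=> //; rewrite t0/=; exact: truncnS_gt.
have mD : measurable D by apply: countable_measurable.
apply/measurable_fun_itv_obnd_cbndP.
have -> : `](0 : R), +oo[%classic = (`]0, +oo[%classic `\` D) `|` D.
  apply/seteqP; split => t /=; rewrite !in_itv/= !andbT.
    by have [Dt|nDt] := pselect (D t); [right|left].
  by case=> [[]//|[]].
apply/measurable_funU => //; first exact: measurableD.
split; last exact: countable_measurable_fun.
apply: subspace_continuous_measurable_fun; first exact: measurableD.
apply: continuous_in_subspaceT => t; rewrite inE/= in_itv/= andbT => -[t0 Dt].
by apply: contrapT => ct; apply: Dt.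
Qed.

(** The one-sided limits bound [h] near every point; compactness of [`[0, T]] makes
    the bound uniform. *)
Lemma piecewise_continuous_bounded h (T : R) : piecewise_continuous h ->
  \forall K \near +oo, forall t, 0 <= t <= T -> `|h t| <= K.
Proof.
move=> [_ right left].
suff : \forall K \near +oo, `[0, T] `<=` (fun t => 0 <= t -> `|h t| <= K).
  apply: filterS => K hK t /andP[t0 tT]; apply: hK => //.
  by rewrite /= in_itv/= t0.
have /compact_near_coveringP := @segment_compact R 0 T; apply => t /=.
rewrite in_itv/= => /andP[t0 tT].
have [l1 /cvgr_norm_ley b1] := (cvg_ex _).1 (right t t0).
have b2 : \forall K \near +oo, \forall u \near t^'-, 0 <= u -> `|h u| <= K.
  have [tE|tN0] := eqVneq t 0.
    apply: nearW => K; near=> u => u0; have : u < t by near: u; exact: nbhs_left_lt.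
    by rewrite tE ltNge u0.
  have [|l2 /cvgr_norm_ley] := (cvg_ex _).1 (left t _); first by rewrite lt_neqAle eq_sym tN0.
  by apply: filterS => K; apply: filterS.
have [K [K1 K2 K3]] : exists K, [/\ \forall u \near t^'+, `|h u| <= K,
    \forall u \near t^'-, 0 <= u -> `|h u| <= K & `|h t| <= K].
  near (pinfty_nbhs R) => K; exists K; split; near: K => //.
  exact: nbhs_pinfty_ge.
exists ([set u | 0 <= u -> `|h u| <= K], [set L | K <= L]); last first.
  by move=> [u L] /= [hu KL] u0; apply: le_trans KL; exact: hu.
split=> /=; last by apply: nbhs_pinfty_ge; exact: num_real.
move: K1 K2; rewrite !near_withinE => K1 K2.
apply: filter_app K1; apply: filter_app K2; near=> u => ul ur u0.
by case: (ltgtP u t) => [ut|ut|->]; [exact: ul|exact: ur|].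
Unshelve. all: by end_near. Qed.

(** Beyond the growth rate [c] of [h], the integrand is dominated by a multiple of
    [expR (- ((s - c) * t))]: past [T] by exponential order, before [T + 1] because
    [h] is bounded there. *)
Lemma laplace_integrable h : piecewise_continuous h -> exponential_order h ->
  \forall s \near +oo,
    mu.-integrable `[0, +oo[ (EFin \o (fun t => h t * expR (- (s * t)))).
Proof.
move=> pc [A [c]] [T [_ hT]].
have [K [K0 hK]] : exists K, 0 <= K /\ forall t, 0 <= t <= T + 1 -> `|h t| <= K.
  near (pinfty_nbhs R) => K; exists K; split; near: K.
    exact: nbhs_pinfty_ge.
  exact: piecewise_continuous_bounded.
have mh := piecewise_continuous_measurable h pc.
near=> s.
have s0 : 0 <= s by near: s; exact: nbhs_pinfty_ge.
have sc : 0 < s - c by rewrite subr_gt0; near: s; apply: nbhs_pinfty_gt; exact: num_real.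
(* The first summand covers t <= T + 1, the second t > T. *)
pose C := K * expR ((s - c) * (T + 1)) + `|A|.
have [ig _] := laplace_powR (s - c) 0 sc (lexx 0).
have iC := integrableZl _ C ig.
apply: le_integrable (iC _) => //.
  apply/measurable_EFinP; apply: measurable_funM => //.
  by apply: measurable_funTS; exact: measurable_expRMN.
move=> t; rewrite /= in_itv/= andbT => t0; rewrite powRr0 mul1r lee_fin.
rewrite !normrM !(ger0_norm (expR_ge0 _)).
rewrite (_ : `|C| = C); last first.
  by rewrite ger0_norm// addr_ge0// mulr_ge0// expR_ge0.
rewrite mulrDl -mulrA -expRD.
have [tT|Tt] := leP t (T + 1).
  rewrite -[leLHS]addr0 lerD ?mulr_ge0 ?expR_ge0// ler_pM ?expR_ge0//.
    by rewrite hK// t0.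
  rewrite ler_expR (@le_trans _ _ 0)// ?oppr_le0 ?mulr_ge0//.
  by rewrite -mulrBr mulr_ge0 ?subr_ge0// ltW.
rewrite -[leLHS]add0r lerD ?mulr_ge0 ?expR_ge0//.
have Tt' : T < t by apply: lt_trans Tt; rewrite ltrDl.
apply: le_trans (_ : A * expR (c * t) * expR (- (s * t)) <= _).
  by rewrite ler_wpM2r ?expR_ge0// hT.
rewrite -mulrA -expRD (_ : c * t + _ = - ((s - c) * t)); last by ring.
by rewrite ler_wpM2r ?expR_ge0// ler_norm.
Unshelve. all: by end_near. Qed.

Lemma Laplace_fseriesD alpha v n f h s : 0 < alpha -> 0 < s ->
  mu.-integrable `[0, +oo[ (EFin \o (fun t => h t * expR (- (s * t)))) ->
  (forall t, 0 <= t -> f t = fseries alpha v n t + h t) ->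
  Laplace f s = \sum_(j < n) v j / s `^ (1 + j%:R * alpha) + Laplace h s.
Proof.
move=> a0 s0 ih fE; rewrite /Laplace.
transitivity (\int[mu]_(t in `[0, +oo[)
    (fseries alpha v n t * expR (- (s * t)) + h t * expR (- (s * t)))).
  by apply: eq_Rintegral => t; rewrite inE/= in_itv/= andbT => t0; rewrite fE// mulrDl.
suff [is1 <-] :
    mu.-integrable `[0, +oo[ (EFin \o (fun t => fseries alpha v n t * expR (- (s * t)))) /\
    \int[mu]_(t in `[0, +oo[) (fseries alpha v n t * expR (- (s * t))) =
    \sum_(j < n) v j / s `^ (1 + j%:R * alpha).
  by rewrite RintegralD.
elim: n {f fE} => [|n [IHi IHv]].
  rewrite big_ord0 (_ : (fun t => _ * expR _) = fun=> 0); last first.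
    by apply/funext => t; rewrite /fseries big_ord0 mul0r.
  by split; [exact: integrable0|rewrite /Rintegral integral0].
have b0 : 0 <= n%:R * alpha by rewrite mulr_ge0// ltW.
have [ip vp] := laplace_powR s _ s0 b0.
pose d := v n / Gamma (1 + n%:R * alpha).
have E : (fun t => fseries alpha v n.+1 t * expR (- (s * t))) =
  (fun t => fseries alpha v n t * expR (- (s * t)) +
     d * (t `^ (n%:R * alpha) * expR (- (s * t)))).
  by apply/funext => t; rewrite /fseries big_ord_recr/= /fmono /d; ring.
have id : mu.-integrable `[0, +oo[ (EFin \o (fun t => d * (t `^ (n%:R * alpha) * expR (- (s * t))))).
  by apply: (integrableZl _ d ip).
rewrite E; split; first by apply: (integrableD _ IHi id).
rewrite RintegralD// IHv RintegralZl// vp big_ord_recr/=; congr (_ + _).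
by rewrite /d mulrA divfK// gt_eqF// Gamma_gt0// ltr_pwDl.
Qed.

End LaplaceTransform.

(** * Matching coefficients at infinity *)

Section Asymptotics.
Context {R : realType} {T : Type} (F : set_system T) {FF : ProperFilter F}.

(** Writing [p = q * 'X + c], convergence of [p] forces [q] to tend to [0] at
    infinity, so [q = 0] by induction. *)
Lemma cvg_horner_constant (y : T -> R) (p : {poly R}) (l : R) :
  y t @[t --> F] --> +oo -> p.[y t] @[t --> F] --> l -> p = l%:P.
Proof.
move=> yoo; have y0 : \forall t \near F, 0 < y t.
  by move/cvgryPgt: yoo; apply.
have yV : (y t)^-1 @[t --> F] --> 0 by apply/gtr0_cvgV0.
elim/poly_ind: p l => [|q c IH] l pl.
  move: pl; under eq_cvg do rewrite horner0.
  by move=> /(cvg_unique (@Rhausdorff R) (cvg_cst 0)) <-; rewrite polyC0.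
suff q0 : q = 0.
  move: pl; rewrite q0 mul0r add0r => cl; congr (_%:P).
  move: cl; under eq_cvg do rewrite hornerC.
  exact: (cvg_unique (@Rhausdorff R) (cvg_cst c)).
rewrite -polyC0; apply: IH.
have : (((q * 'X + c%:P).[y t] - c) * (y t)^-1) @[t --> F] --> (l - c) * 0.
  by apply: cvgM => //; apply: cvgB => //; exact: cvg_cst.
rewrite mulr0; apply: cvg_trans; apply: near_eq_cvg.
near=> t; rewrite hornerD hornerM hornerX hornerC addrK mulfK// gt_eqF//.
by near: t.
Unshelve. all: by end_near. Qed.

(** Adding the two hypotheses eliminates [m]; the terms with [j > K] are negative
    powers of [y] and vanish in the limit.  What remains is a polynomial in [y] that
    converges at infinity, and its constant coefficient is [phi K - v K]. *)
Lemma leading_balance (y m : T -> R) (phi v u : nat -> R) (l : R) (K r : nat) :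
  y t @[t --> F] --> +oo ->
  m t - \sum_(j < K) u j * y t ^+ (K - j) @[t --> F] --> l ->
  \sum_(j < K.+1) phi j * y t ^+ (K - j)
    - \sum_(j < K.+1 + r) v j * (y t ^+ K / y t ^+ j) - m t @[t --> F] --> 0 ->
  phi K = v K + l.
Proof.
move=> yoo Hm H0.
have y0 : \forall t \near F, 0 < y t by move/cvgryPgt: yoo; apply.
have yV : (y t)^-1 @[t --> F] --> 0 by apply/gtr0_cvgV0.
have Htail : \sum_(i < r) v (K.+1 + i)%N * ((y t)^-1 ^+ i.+1) @[t --> F] --> 0.
  have := @cvg_sum_ord R T F _ r (fun i t => v (K.+1 + i)%N * ((y t)^-1 ^+ i.+1))
    (fun i => v (K.+1 + i)%N * 0 ^+ i.+1).
  rewrite [X in _ --> X]big1; last by move=> i _; rewrite expr0n/= mulr0.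
  apply => i _; apply: cvgM; first exact: cvg_cst.
  exact: cvg_comp yV (@exprn_continuous _ _ _).
pose d j := phi j - v j - (if (j < K)%N then u j else 0).
pose Q : {poly R} := \sum_(j < K.+1) d j *: 'X^(K - j).
have QE : Q = l%:P.
  apply: (cvg_horner_constant y) => //.
  rewrite -[l]add0r -[0 + l]addr0; apply: cvg_trans (cvgD (cvgD H0 Hm) Htail).
  apply: near_eq_cvg; near=> t.
  have yt0 : y t != 0 by rewrite gt_eqF//; near: t.
  rewrite !fctE big_split_ord/=.
  have -> : \sum_(i < r) v (K.+1 + i)%N * (y t ^+ K / y t ^+ (K.+1 + i)) =
      \sum_(i < r) v (K.+1 + i)%N * (y t)^-1 ^+ i.+1.
    apply: eq_bigr => i _; congr (_ * _).
    by rewrite addSnnS exprD invfM mulrA divff ?mul1r ?exprVn// expf_neq0.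
  have -> : \sum_(i < K.+1) v i * (y t ^+ K / y t ^+ i) =
      \sum_(i < K.+1) v i * y t ^+ (K - i).
    apply: eq_bigr => i _; congr (_ * _).
    have iK : (i <= K)%N by rewrite -ltnS.
    by rewrite -[X in y t ^+ X / _](subnK iK) exprD mulfK// expf_neq0.
  have -> : Q.[y t] = \sum_(j < K.+1) phi j * y t ^+ (K - j) -
      \sum_(j < K.+1) v j * y t ^+ (K - j) - \sum_(j < K) u j * y t ^+ (K - j).
    rewrite /Q horner_sum.
    under eq_bigr do rewrite hornerZ hornerXn /d !mulrBl.
    rewrite !sumrB; congr (_ - _).
    rewrite big_ord_recr/= ltnn mul0r addr0; apply: eq_bigr => j _.
    by rewrite ltn_ord.
  by ring.
have := congr1 (fun p : {poly R} => p`_0) QE.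
rewrite /Q coefC/= coef_sum big_ord_recr/= subnn coefZ coefXn eqxx mulr1.
rewrite big1 ?add0r; last first.
  by move=> j _; rewrite coefZ coefXn eq_sym subn_eq0 leqNgt ltn_ord mulr0.
by rewrite /d ltnn subr0 => <-; rewrite addrC subrK.
Unshelve. all: by end_near. Qed.

End Asymptotics.

(** * Derivatives on an interval *)

Section IteratedDerivative.
Context {R : realType} (I : set R).
Hypothesis itvI : is_interval I.
Hypothesis ndI : exists a b : R, [/\ I a, I b & a < b].

(** Every point of a nondegenerate interval is a limit point of it, so limits of
    difference quotients are unique. *)
Lemma within_interval_proper x : I x -> ProperFilter (within I x^').
Proof.
move=> Ix; apply: Build_ProperFilter_ex => P.
rewrite /within /dnbhs /within/= => /nbhs_ballP[e /= e0 eP].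
have [a [b [Ia Ib ab]]] := ndI.
have e2 : 0 < e / 2 by rewrite divr_gt0.
have [xb|bx] := ltP x b.
  exists (Num.min b (x + e / 2)).
  have xm : x < Num.min b (x + e / 2) by rewrite lt_min xb ltrDl.
  apply: eP.
  - rewrite /ball/= distrC gtr0_norm ?subr_gt0//.
    rewrite ltrBlDl (@le_lt_trans _ _ (x + e / 2))//.
      by rewrite ge_min lexx orbT.
    by rewrite ltrD2l ltr_pdivrMr// ltr_pMr// ltr1n.
  - by rewrite gt_eqF.
  - by apply: (itvI _ _ Ix Ib); rewrite (ltW xm)/= ge_min lexx.
have ax : a < x by exact: lt_le_trans bx.
exists (Num.max a (x - e / 2)).
have xm : Num.max a (x - e / 2) < x by rewrite gt_max ax ltrBlDr ltrDl.
apply: eP.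
- rewrite /ball/= gtr0_norm ?subr_gt0//.
  rewrite ltrBlDr -ltrBlDl (@lt_le_trans _ _ (x - e / 2))//.
    by rewrite ltrD2l ltrN2 ltr_pdivrMr// ltr_pMr// ltr1n.
  by rewrite le_max lexx orbT.
- by rewrite lt_eqF.
- by apply: (itvI _ _ Ia Ix); rewrite (ltW xm)/= le_max lexx.
Qed.

Lemma deriven_inS q (f : R -> R) x :
  deriven_in I q.+1 f x = deriv_in I (deriven_in I q f) x.
Proof. by []. Qed.

(** The quotients of order [q] are linear at all [y] in [I], which needs the
    linearity of the derivatives of order [q] on the whole of [I] and not only at [x]. *)
Lemma deriven_in_lin N (f g : R -> R) c : times_derivable_in I N f ->
  times_derivable_in I N g ->
  times_derivable_in I N (fun y => f y + c * g y) /\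
  forall q x, (q <= N)%N -> I x ->
    deriven_in I q (fun y => f y + c * g y) x =
    deriven_in I q f x + c * deriven_in I q g x.
Proof.
move=> df dg; pose F y := f y + c * g y.
have step q x : (q < N)%N -> I x ->
    (forall y, I y -> deriven_in I q F y = deriven_in I q f y + c * deriven_in I q g y) ->
    quotient_in (deriven_in I q F) x y @[y --> within I x^'] -->
      deriven_in I q.+1 f x + c * deriven_in I q.+1 g x.
  move=> qN Ix E; have FF := within_interval_proper x Ix.
  have cf := df q qN x Ix; have cg := dg q qN x Ix.
  apply: cvg_trans (cvgD cf (cvgM (cvg_cst c) cg)).
  apply: near_eq_cvg; near=> y.
  have Iy : I y by near: y; exact: withinT.
  rewrite !fctE /quotient_in/= !E//.
  by ring.
have val q : (q <= N)%N -> forall x, I x ->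
    deriven_in I q F x = deriven_in I q f x + c * deriven_in I q g x.
  elim: q => [//|q IH] qN x Ix.
  have FF := within_interval_proper x Ix.
  rewrite {1}deriven_inS /deriv_in; apply: cvg_lim => //.
  by apply: step => // y Iy; apply: IH => //; exact: ltnW.
split; last by move=> q x qN; exact: val.
move=> q qN x Ix; apply/cvg_ex; eexists.
by apply: (step q x qN Ix) => y Iy; apply: val => //; exact: ltnW.
Unshelve. all: by end_near. Qed.

Lemma deriven_in_sum N (f0 : R -> R) (g : nat -> R -> R) (c : nat -> R) k :
  times_derivable_in I N f0 ->
  (forall n, (1 <= n)%N -> times_derivable_in I N (g n)) ->
  times_derivable_in I N (fun y => f0 y + \sum_(1 <= n < k.+1) c n * g n y) /\
  forall q x, (q <= N)%N -> I x ->
    deriven_in I q (fun y => f0 y + \sum_(1 <= n < k.+1) c n * g n y) x =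
    deriven_in I q f0 x + \sum_(1 <= n < k.+1) c n * deriven_in I q (g n) x.
Proof.
move=> d0 dg; elim: k => [|k [IHd IHv]].
  rewrite (_ : (fun y => _) = f0); last first.
    by apply/funext => y; rewrite big_geq// addr0.
  by split=> // q x _ _; rewrite big_geq// addr0.
rewrite (_ : (fun y => _) = fun y =>
   (f0 y + \sum_(1 <= n < k.+1) c n * g n y) + c k.+1 * g k.+1 y); last first.
  by apply/funext => y; rewrite big_nat_recr//= addrA.
have [dd vv] := deriven_in_lin N _ _ (c k.+1) IHd (dg k.+1 isT).
split=> // q x qN Ix.
by rewrite vv// IHv// [in RHS]big_nat_recr//= addrA.
Qed.

End IteratedDerivative.

(** * Polynomials modulo a power of the variable *)

Section Truncation.
Context {R : comNzRingType} (n : nat).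
Implicit Types p q : {poly R}.

(** Congruence modulo ['X^n]. *)
Definition eq_below p q := exists r, p = q + 'X^n * r.

Lemma eq_below_refl p : eq_below p p.
Proof. by exists 0; rewrite mulr0 addr0. Qed.

Lemma eq_belowD p1 q1 p2 q2 :
  eq_below p1 q1 -> eq_below p2 q2 -> eq_below (p1 + p2) (q1 + q2).
Proof. by move=> [r ->] [s ->]; exists (r + s); ring. Qed.

Lemma eq_belowM p1 q1 p2 q2 :
  eq_below p1 q1 -> eq_below p2 q2 -> eq_below (p1 * p2) (q1 * q2).
Proof. by move=> [r ->] [s ->]; exists (r * q2 + q1 * s + 'X^n * r * s); ring. Qed.

Lemma eq_belowX p q m : eq_below p q -> eq_below (p ^+ m) (q ^+ m).
Proof.
move=> pq; elim: m => [|m IH]; first exact: eq_below_refl.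
by rewrite !exprS; exact: eq_belowM.
Qed.

Lemma eq_below_sum a b (p q : nat -> {poly R}) :
  (forall i, eq_below (p i) (q i)) ->
  eq_below (\sum_(a <= i < b) p i) (\sum_(a <= i < b) q i).
Proof.
move=> pq; elim/big_rec2: _ => [|i x y _ xy]; first exact: eq_below_refl.
exact: eq_belowD.
Qed.

Lemma eq_below_coef p q i : eq_below p q -> (i < n)%N -> p`_i = q`_i.
Proof. by move=> [r ->] ilt; rewrite coefD coefXnM ilt addr0. Qed.

End Truncation.

(** * The operator along a truncated series *)

Section Operator.
Context {R : realType} (I : set R) (alpha : R) (M N : nat).
Variables (c : nat -> R -> R) (h : R -> R -> R) (f0 : R -> R) (phi : nat -> R -> R).
Hypothesis itvI : is_interval I.
Hypothesis ndI : exists a b : R, [/\ I a, I b & a < b].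
Hypothesis alpha0 : 0 < alpha.
Hypothesis df0 : times_derivable_in I N f0.
Hypothesis dphi : forall n, (1 <= n)%N -> times_derivable_in I N (phi n).

(** The polynomial in [t `^ alpha] that [D_x^q] of the truncated series is, at
    [x]; [q = 0] gives the series itself. *)
Definition dpoly k q x : {poly R} :=
  (deriven_in I q f0 x)%:P + \sum_(1 <= n < k.+1)
    (deriven_in I q (phi n) x / Gamma (1 + n%:R * alpha)) *: 'X^n.

Definition opoly k x : {poly R} :=
  \sum_(1 <= p < M.+1) \sum_(0 <= q < N.+1)
    (c p x)%:P * dpoly k 0 x ^+ p * dpoly k q x.

Lemma powR_natmul t n : 0 <= t -> t `^ (n%:R * alpha) = (t `^ alpha) ^+ n.
Proof. by move=> t0; rewrite mulrC powRrM powR_mulrn// powR_ge0. Qed.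

Lemma deriven_in_invPsi k q x t : (q <= N)%N -> I x -> 0 <= t ->
  deriven_in I q (fun y => invPsi alpha f0 phi k y t) x = (dpoly k q x).[t `^ alpha].
Proof.
move=> qN Ix t0.
have [_ v] := deriven_in_sum I itvI ndI N f0 phi
  (fun n => t `^ (n%:R * alpha) / Gamma (1 + n%:R * alpha)) k df0 dphi.
rewrite (_ : (fun y => _) = fun y => f0 y + \sum_(1 <= n < k.+1)
    t `^ (n%:R * alpha) / Gamma (1 + n%:R * alpha) * phi n y); last first.
  apply/funext => y; rewrite /invPsi; congr (_ + _).
  by apply: eq_bigr => n _; rewrite mulrAC.
rewrite v// /dpoly hornerD hornerC horner_sum; congr (_ + _).
by apply: eq_bigr => n _; rewrite hornerZ hornerXn powR_natmul//; ring.
Qed.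

Lemma opR_invPsi k x t : I x -> 0 <= t ->
  opR I M N c h (invPsi alpha f0 phi k) x t = (opoly k x).[t `^ alpha] + h x t.
Proof.
move=> Ix t0; rewrite /opR /opoly; congr (_ + _).
rewrite horner_sum; apply: eq_bigr => p _.
rewrite horner_sum; apply: eq_big_nat => q /andP[_ qN].
by rewrite !hornerM hornerC horner_exp -!deriven_in_invPsi.
Qed.

(** The operator is built from sums and products, which respect congruence modulo
    ['X^k.+1], and the new term of the series is a multiple of ['X^k.+1]. *)
Lemma opoly_coef k x : (opoly k.+1 x)`_k = (opoly k x)`_k.
Proof.
apply: (@eq_below_coef _ k.+1) => //.
have D q : eq_below k.+1 (dpoly k.+1 q x) (dpoly k q x).
  rewrite /dpoly big_nat_recr//= addrA.
  exists (deriven_in I q (phi k.+1) x / Gamma (1 + k.+1%:R * alpha))%:P.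
  by congr (_ + _); rewrite -mul_polyC; exact: mulrC.
apply: eq_below_sum => p; apply: eq_below_sum => q.
apply: eq_belowM => //; apply: eq_belowM; first exact: eq_below_refl.
exact: eq_belowX.
Qed.

End Operator.

(** * Coefficients of the residual series *)

Section Coefficients.
Context {R : realType} (alpha : R).
Hypothesis alpha0 : 0 < alpha.

Lemma powR_cvgy : s `^ alpha @[s --> +oo] --> +oo.
Proof.
apply/cvgryPge => A; near=> s.
have sB : Num.max A 1 `^ alpha^-1 <= s.
  by near: s; apply: nbhs_pinfty_ge; exact: num_real.
apply: (@le_trans _ _ (Num.max A 1)); first by rewrite le_max lexx.
have m0 : 0 <= Num.max A 1 by rewrite le_max ler01 orbT.
rewrite -[leLHS]powRr1// -(@mulVf _ alpha) ?gt_eqF// powRrM.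
have s0 : 0 <= s by apply: le_trans sB; exact: powR_ge0.
by apply: ge0_ler_powR => //; [exact: ltW|rewrite nnegrE powR_ge0].
Unshelve. all: by end_near. Qed.

(** [n] may exceed the size of [p], so that the series can be given a length
    suited to the number of derivatives taken. *)
Lemma horner_fseries (p : {poly R}) n t : (size p <= n)%N -> 0 <= t ->
  p.[t `^ alpha] = fseries alpha (fun j => Gamma (1 + j%:R * alpha) * p`_j) n t.
Proof.
move=> pn t0; rewrite (horner_coef_wide _ pn) /fseries.
apply: eq_bigr => j _; rewrite /fmono powR_natmul//.
have : 0 < Gamma (1 + j%:R * alpha).
  by rewrite Gamma_gt0// ltr_pwDl// mulr_ge0// ltW.
by move=> g0; field; rewrite gt_eqF.
Qed.

(** The transform rule for the [K]-fold derivative, multiplied by [s], is the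
    remainder of the expansion of [Laplace g] at infinity, and the initial value
    rule computes its limit. *)
Lemma laplace_initial_expansion (g : R -> R) K :
  initial_value_rule (caputo_iter alpha K g) -> laplace_caputo_rule alpha K g ->
  s * (s `^ alpha) ^+ K * Laplace g s
    - \sum_(j < K) at0 (caputo_iter alpha j g) * (s `^ alpha) ^+ (K - j)
    @[s --> +oo] --> at0 (caputo_iter alpha K g).
Proof.
move=> gi gl; apply: cvg_trans gi; apply: near_eq_cvg.
near=> s; have s0 : 0 < s by near: s; exact: nbhs_pinfty_gt.
have -> : Laplace (caputo_iter alpha K g) s =
      s `^ (K%:R * alpha) * Laplace g s
      - \sum_(0 <= k < K) s `^ ((K - k)%:R * alpha - 1) * at0 (caputo_iter alpha k g).
  by near: s.
rewrite mulrBr mulrA powR_natmul ?ltW//; congr (_ - _).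
rewrite big_mkord mulr_sumr; apply: eq_bigr => j _.
rewrite mulrA -powR_natmul ?ltW// mulr_powRB1 ?ltW//; first exact: mulrC.
by rewrite mulr_gt0// ltr0n subn_gt0.
Unshelve. all: by end_near. Qed.

End Coefficients.
Theorem mainTheorem1 (R : realType) (I : set R) (alpha : R) (M N : nat)
    (c : nat -> R -> R) (h : R -> R -> R)
    (f0 : R -> R) (phi : nat -> R -> R)
    (itvI : is_interval I)
    (ndI : exists a b : R, [/\ I a, I b & a < b])
    (halpha : 0 < alpha <= 1)
    (hM : (1 <= M)%N)
    (* standing conventions *)
    (df0 : times_derivable_in I N f0)
    (dphi : forall n, (1 <= n)%N -> times_derivable_in I N (phi n))
    (hD : forall x, I x -> forall j,
      caputo_exists alpha (caputo_iter alpha j (h x)))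
    (hpc : forall x, I x -> forall j,
      piecewise_continuous (caputo_iter alpha j (h x)))
    (hexp : forall x, I x -> forall j,
      exponential_order (caputo_iter alpha j (h x)))
    (hinit : forall x, I x -> forall j,
      initial_value_rule (caputo_iter alpha j (h x)))
    (hlap : forall x, I x -> forall n, laplace_caputo_rule alpha n (h x))
    (* the coefficients of the Laplace residual power series solution *)
    (phi0 : forall x, I x -> phi 0%N x = f0 x)
    (hres : forall k, (1 <= k)%N -> forall x, I x ->
      s `^ (k%:R * alpha + 1) * LRes I alpha M N c h f0 phi k x s
        @[s --> +oo] --> (0 : R)) :
  forall x, I x ->
    (opR I M N c h (fun y _ => f0 y) x t @[t --> 0^'+] --> phi 1%N x)
    /\
    forall k, (2 <= k)%N ->
      caputo_iter alpha k.-1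
        (opR I M N c h (invPsi alpha f0 phi k.-1) x) t
        @[t --> 0^'+] --> phi k x.

Proof.
have /andP[alpha0 _] := halpha.
(* The first claim is the case K = 0, since the series of length 0 is f0. *)
suff main x K : I x -> caputo_iter alpha K
    (opR I M N c h (invPsi alpha f0 phi K) x) t @[t --> 0^'+] --> phi K.+1 x.
  move=> x Ix; split; last by case=> [//|k] _; exact: main.
  have := main x 0%N Ix; rewrite /= (_ : invPsi alpha f0 phi 0 = fun y _ => f0 y)//.
  by apply/funext => y; apply/funext => t; rewrite /invPsi big_geq// addr0.
move=> Ix.
pose P k := opoly I alpha M N c f0 phi k x.
pose v k j := Gamma (1 + j%:R * alpha) * (P k)`_j.
pose u j := at0 (caputo_iter alpha j (h x)).
have opE k n t : (size (P k) <= n)%N -> 0 <= t ->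
    opR I M N c h (invPsi alpha f0 phi k) x t = fseries alpha (v k) n t + h x t.
  by move=> kn t0; rewrite opR_invPsi// (horner_fseries alpha alpha0 _ n).
(* The Laplace side; the residual of index K + 1 involves P (K + 1). *)
have phiE : phi K.+1 x = v K K + u K.
  have -> : v K K = v K.+1 K by rewrite /v /P opoly_coef.
  pose r := size (P K.+1).
  apply: (@leading_balance _ _ (+oo : set_system R) _ (fun s => s `^ alpha)
    (fun s => s * (s `^ alpha) ^+ K * Laplace (h x) s)
    (fun j => phi j.+1 x) (v K.+1) u (u K) K r).
  - exact: powR_cvgy.
  - exact: (laplace_initial_expansion alpha alpha0 _ _ (hinit x Ix K) (hlap x Ix K)).
  apply: cvg_trans (hres K.+1 isT x Ix); apply: near_eq_cvg; near=> s.
  have s0 : 0 < s by near: s; exact: nbhs_pinfty_gt.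
  rewrite /LRes (Laplace_fseriesD alpha (v K.+1) (K.+1 + r) _ (h x))//; first last.
  - by move=> t t0; apply: opE => //; rewrite leq_addl.
  - by near: s; apply: laplace_integrable; [exact: (hpc x Ix 0%N)|exact: (hexp x Ix 0%N)].
  have y0 : 0 < s `^ alpha by exact: powR_gt0.
  have E n : s `^ (1 + n%:R * alpha) = s * (s `^ alpha) ^+ n.
    rewrite powRD; last by rewrite (gt_eqF s0) implybT.
    by rewrite powRr1 ?ltW// powR_natmul ?ltW.
  have -> : s `^ (K.+1%:R * alpha + 1) = s * (s `^ alpha) ^+ K.+1 by rewrite addrC E.
  have -> : Psi alpha f0 phi K.+1 x s - f0 x / s =
      \sum_(j < K.+1) phi j.+1 x / s `^ (1 + j.+1%:R * alpha).
    by rewrite /Psi addrAC subrr add0r big_add1 big_mkord.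
  move: (s `^ alpha) y0 E => y y0 E.
  have yn0 n : y ^+ n != 0 by rewrite expf_neq0// gt_eqF.
  have sn0 : s != 0 by rewrite gt_eqF.
  rewrite mulrBr mulr_sumr mulrA mulrDr mulr_sumr opprD addrA.
  congr (_ - _ - _).
  - apply: eq_bigr => j _; have jK : (j <= K)%N by rewrite -ltnS.
    rewrite E -[X in y ^+ X.+1](subnK jK) -addnS exprD.
    move: (y ^+ j.+1) (yn0 j.+1) (y ^+ (K - j)) => z z0 w.
    by field; rewrite sn0 z0.
  - apply: eq_bigr => j _; rewrite E exprS.
    move: (y ^+ j) (yn0 j) (y ^+ K) => z z0 w.
    by field; rewrite sn0 z0 gt_eqF.
  - by rewrite exprS; field; rewrite gt_eqF.
rewrite phiE.
(* Long enough that a nonempty series is left after K derivatives. *)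
pose n := (size (P K) + K).+1.
have ch t : 0 < t -> caputo_iter alpha K (opR I M N c h (invPsi alpha f0 phi K) x) t =
    fseries alpha (fun j => v K (j + K)%N) (size (P K)).+1 t + caputo_iter alpha K (h x) t.
  move=> t0; rewrite (caputo_iter_fseriesD alpha halpha (v K) n _ (h x))//.
  - by rewrite /n -addSn addnK.
  - exact: hD.
  - by move=> t' t'0; apply: opE; [rewrite /n -addnS leq_addr|exact: ltW].
have hu : caputo_iter alpha K (h x) t @[t --> 0^'+] --> u K.
  by have [_ right _] := hpc x Ix K; exact: right.
apply: cvg_trans (cvgD (fseries_at0 alpha halpha (fun j => v K (j + K)%N) (size (P K))) hu).
apply: near_eq_cvg; near=> t; rewrite fctE ch//; near: t; exact: nbhs_right_gt.
Unshelve. all: by end_near. Qed.
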